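(* Let $x\in\mathbb{Z}^3$ have norm $nm^2$, where $n,m$ are positive integers and $n$ is squarefree. Then there exists an icube $(u,v,w)$ in $\mathbb{Z}^3$ with edge length $m$ such that the corresponding cubic lattice contains $x$. If $x$ is primitive, then this cubic lattice is unique (among cubic lattices of icubes with edge length $m$ containing $x$), and it is the subgroup generated by the columns of an Euler matrix $E(\alpha)$ for some quaternion $\alpha$ with integer coefficients.
   Context: The norm of $v\in\mathbb{Z}^3$ is its squared Euclidean length. An icube in $\mathbb{Z}^3$ is a triple $(u,v,w)$ of nonzero, pairwise orthogonal vectors of $\mathbb{Z}^3$ of the same length (the edge length); its cubic lattice is the subgroup of $\mathbb{Z}^3$ generated by $u,v,w$. A vector is primitive if the gcd of its components is $1$. For a real quaternion $\alpha=m'+n'i+p'j+q'k$ the Euler matrix is $$E(\alpha)=\begin{pmatrix} m'^2+n'^2-p'^2-q'^2 & -2m'q'+2n'p' & 2m'p'+2n'q'\\ 2m'q'+2n'p' & m'^2-n'^2+p'^2-q'^2 & -2m'n'+2p'q'\\ -2m'p'+2n'q' & 2m'n'+2p'q' & m'^2-n'^2-p'^2+q'^2\end{pmatrix},$$ the matrix (in basis $i,j,k$, identifying $(v_1,v_2,v_3)$ with $v_1i+v_2j+v_3k$) of the map $\beta\mapsto\alpha\beta\overline{\alpha}$ on pure quaternions. *)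

(* Defs.v *)
From mathcomp Require Import all_boot all_order all_algebra.
Set Implicit Arguments.
Unset Strict Implicit.
Unset Printing Implicit Defensive.
Import GRing.Theory.
Local Open Scope ring_scope.

Definition squarefree (n : nat) : Prop :=
  forall d : nat, (d ^ 2 %| n)%N -> d = 1%N.

Definition dot (u v : 'cV[int]_3) : int := \sum_i u i 0 * v i 0.

(* The norm is the SQUARED Euclidean length. *)
Definition norm (v : 'cV[int]_3) : int := dot v v.

Definition primitive (v : 'cV[int]_3) : Prop := \big[gcdz/0]_i v i 0 = 1.

(* Equality of lengths is stated as equality of their squares, the norms. *)
Definition icube (u v w : 'cV[int]_3) : Prop :=
  [/\ [/\ u != 0, v != 0 & w != 0],
      [/\ dot u v = 0, dot u w = 0 & dot v w = 0]
    & norm u = norm v /\ norm v = norm w].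

(* Having length m >= 0 means having norm m ^ 2; by [icube], the length of u
   is the common length of the three edges. *)
Definition icube_of_edge (m : nat) (u v w : 'cV[int]_3) : Prop :=
  icube u v w /\ norm u = (m ^ 2)%:Z.

Definition cubic_lattice (u v w : 'cV[int]_3) (y : 'cV[int]_3) : Prop :=
  inIntSpan [tuple u; v; w] y.

(* The quaternion qre + qi i + qj j + qk k. *)
Record quaternion (R : Type) := Quaternion { qre : R; qi : R; qj : R; qk : R }.

Definition Euler_matrix (R : comNzRingType) (alpha : quaternion R) : 'M[R]_3 :=
  let: Quaternion m n p q := alpha in
  let rows : seq (seq R) :=
    [:: [:: m ^+ 2 + n ^+ 2 - p ^+ 2 - q ^+ 2;
            - (m * q) *+ 2 + (n * p) *+ 2;
            (m * p) *+ 2 + (n * q) *+ 2];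
        [:: (m * q) *+ 2 + (n * p) *+ 2;
            m ^+ 2 - n ^+ 2 + p ^+ 2 - q ^+ 2;
            - (m * n) *+ 2 + (p * q) *+ 2];
        [:: - (m * p) *+ 2 + (n * q) *+ 2;
            (m * n) *+ 2 + (p * q) *+ 2;
            m ^+ 2 - n ^+ 2 - p ^+ 2 + q ^+ 2]] in
  \matrix_(i < 3, j < 3) nth 0 (nth [::] rows i) j.

Definition column_lattice (A : 'M[int]_3) (y : 'cV[int]_3) : Prop :=
  inIntSpan [tuple col j A | j < 3] y.

(* Main.v *)
Require Import Defs.
From mathcomp Require Import all_boot all_order all_algebra.
From mathcomp Require Import ring lra zify.
Set Implicit Arguments.
Unset Strict Implicit.
Unset Printing Implicit Defensive.
Import Order.TTheory GRing.Theory Num.Theory.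
Local Open Scope ring_scope.

(* Existence.  By induction on m it is enough to treat a prime p with p^2
   dividing the norm of x.  If p divides x, scale; this covers p = 2.  Otherwise
   a Lagrange-style descent finds an integer quaternion of norm p: it runs
   through quaternions g of norm p k, 0 < k < p, such that p^2 divides the vector
   conj(g) x g, starting from the balanced residue of x modulo p, and decreases k
   by passing from g to g h / 2 with h one of 1+i, 1+j, 1+k (k even), or to
   g conj(h) / k with h the balanced residue of g modulo k (k odd).  At k = 1,
   x = g y conj(g) for an integral y whose norm is that of x divided by p^2,
   and E(a) E(b) = E(ab) glues the steps together.

   Uniqueness.  Let A have the edges as columns, so A^T A = m^2.  Then the matrix
   of cofactors of A is +-m A, so m divides the cross product of any two lattice
   vectors; as x is primitive, lattice vectors are multiples of x modulo m.  It
   follows that the lattice is Zx + m {t : m | t.x}, which depends only on x. *)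

(** * Coordinates in dimension three *)

Lemma sum3 (V : nmodType) (F : 'I_3 -> V) : \sum_i F i = F 0 + F 1 + F 2%:R.
Proof.
rewrite !big_ord_recr big_ord0 /= add0r.
by congr (F _ + F _ + F _); apply: val_inj.
Qed.

(** Meant as an eliminator: [elim/forall_ord3] replaces an index by each of the three literals, so
    that matrix entries compute. *)
Lemma forall_ord3 (P : 'I_3 -> Prop) : P 0 -> P 1 -> P 2%:R -> forall i, P i.
Proof.
move=> P0 P1 P2 [[|[|[|//]]] lt_i].
- by rewrite (_ : Ordinal _ = 0) //; apply: val_inj.
- by rewrite (_ : Ordinal _ = 1) //; apply: val_inj.
- by rewrite (_ : Ordinal _ = 2%:R) //; apply: val_inj.
Qed.

(** * Quaternion arithmetic and Euler matrices *)

Definition qmul (R : comNzRingType) (a b : quaternion R) : quaternion R :=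
  let: Quaternion a0 a1 a2 a3 := a in let: Quaternion b0 b1 b2 b3 := b in
  Quaternion (a0 * b0 - a1 * b1 - a2 * b2 - a3 * b3)
             (a0 * b1 + a1 * b0 + a2 * b3 - a3 * b2)
             (a0 * b2 - a1 * b3 + a2 * b0 + a3 * b1)
             (a0 * b3 + a1 * b2 - a2 * b1 + a3 * b0).

Definition qconj (R : comNzRingType) (a : quaternion R) : quaternion R :=
  let: Quaternion a0 a1 a2 a3 := a in Quaternion a0 (- a1) (- a2) (- a3).

Definition qscale (R : comNzRingType) (s : R) (a : quaternion R) : quaternion R :=
  let: Quaternion a0 a1 a2 a3 := a in
  Quaternion (s * a0) (s * a1) (s * a2) (s * a3).

Definition qnorm (R : comNzRingType) (a : quaternion R) : R :=
  let: Quaternion a0 a1 a2 a3 := a in a0 ^+ 2 + a1 ^+ 2 + a2 ^+ 2 + a3 ^+ 2.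

Lemma qnormM (R : comNzRingType) (a b : quaternion R) : qnorm (qmul a b) = qnorm a * qnorm b.
Proof. by case: a b => ? ? ? ? [? ? ? ?] /=; ring. Qed.

Lemma Euler_qmul (R : comNzRingType) (a b : quaternion R) :
  Euler_matrix (qmul a b) = Euler_matrix a *m Euler_matrix b.
Proof.
case: a b => a0 a1 a2 a3 [b0 b1 b2 b3].
apply/matrixP; elim/forall_ord3; elim/forall_ord3; rewrite !mxE sum3 !mxE /=; ring.
Qed.

Lemma qnorm_conj (R : comNzRingType) (a : quaternion R) : qnorm (qconj a) = qnorm a.
Proof. by case: a => ? ? ? ? /=; ring. Qed.

Lemma qnorm_scale (R : comNzRingType) (s : R) a : qnorm (qscale s a) = s ^+ 2 * qnorm a.
Proof. by case: a => ? ? ? ? /=; ring. Qed.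

Lemma qconj_mul (R : comNzRingType) (a b : quaternion R) :
  qconj (qmul a b) = qmul (qconj b) (qconj a).
Proof. by case: a b => ? ? ? ? [? ? ? ?] /=; congr Quaternion; ring. Qed.

Lemma qconj_scale (R : comNzRingType) (s : R) a : qconj (qscale s a) = qscale s (qconj a).
Proof. by case: a => ? ? ? ? /=; congr Quaternion; ring. Qed.

Lemma Euler_scale (R : comNzRingType) (s : R) a :
  Euler_matrix (qscale s a) = s ^+ 2 *: Euler_matrix a.
Proof.
case: a => a0 a1 a2 a3.
apply/matrixP; elim/forall_ord3; elim/forall_ord3; rewrite !mxE /=; ring.
Qed.

Lemma Euler_conj (R : comNzRingType) (a : quaternion R) :
  Euler_matrix (qconj a) = (Euler_matrix a)^T.
Proof.
case: a => a0 a1 a2 a3.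
apply/matrixP; elim/forall_ord3; elim/forall_ord3; rewrite !mxE /=; ring.
Qed.

Lemma Euler_mul_conj (R : comNzRingType) (a : quaternion R) :
  Euler_matrix a *m Euler_matrix (qconj a) = (qnorm a ^+ 2)%:M.
Proof.
rewrite -Euler_qmul; case: a => a0 a1 a2 a3.
apply/matrixP; elim/forall_ord3; elim/forall_ord3; rewrite !mxE /=; ring.
Qed.

Lemma Euler_conj_mul (R : comNzRingType) (a : quaternion R) :
  Euler_matrix (qconj a) *m Euler_matrix a = (qnorm a ^+ 2)%:M.
Proof.
rewrite -Euler_qmul; case: a => a0 a1 a2 a3.
apply/matrixP; elim/forall_ord3; elim/forall_ord3; rewrite !mxE /=; ring.
Qed.

(** * Descent on quaternion norms *)

Lemma balanced_residue (k : nat) (a : int) :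
  odd k -> exists r t : int, a = r + k%:Z * t /\ 4 * r ^+ 2 < k%:Z ^+ 2.
Proof.
(* As k = 2h + 1, the residue of a + h, shifted back by h, lies in [-h, h], which makes the bound
   strict. *)
move=> k_odd; pose h := k./2%:Z.
have kE : k%:Z = 2 * h + 1 by rewrite /h; lia.
have h0 : 0 <= h by [].
have k0 : k%:Z != 0 by lia.
have := divz_eq (a + h) k; have := modz_ge0 (a + h) k0.
have := ltz_pmod (a + h) (_ : 0 < k%:Z); rewrite kE; move=> /(_ ltac:(lia)).
set q := divz _ _; set r := modz _ _ => r_lt r_ge E.
exists (r - h), q; split; first lia.
nia.
Qed.

Lemma coprime_scale (n : nat) (s d : int) (v y : 'cV[int]_n) :
  coprimez s d -> s *: v = d *: y -> exists y', v = d *: y'.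
Proof.
move=> /coprimezP [[a b] /= ab1] E; exists (a *: y + b *: v).
rewrite scalerDr !scalerA (mulrC d a) (mulrC d b) -scalerA -E scalerA -scalerDl.
by rewrite ab1 scale1r.
Qed.

(** Since conj(s g') = conj(h) conj(g), the vector s^2 E(conj g') x is divisible by p^2, and s^2 is
    prime to p^2. *)
Lemma descent_step (p : int) (x : 'cV[int]_3) (s : int) (g h g' : quaternion int) :
  coprimez s p -> qmul g h = qscale s g' ->
  (exists y, Euler_matrix (qconj g) *m x = p ^+ 2 *: y) ->
  exists y, Euler_matrix (qconj g') *m x = p ^+ 2 *: y.
Proof.
move=> s_p gh [y gy].
apply: (@coprime_scale _ (s ^+ 2) _ _ (Euler_matrix (qconj h) *m y)).
  by rewrite coprimezXl // coprimezXr.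
rewrite scalemxAl -Euler_scale -qconj_scale -gh qconj_mul Euler_qmul -mulmxA gy.
by rewrite scalemxAr.
Qed.

Lemma qnorm_step (k l : int) (g h g' : quaternion int) (s p : int) : s != 0 ->
  qmul g h = qscale s g' -> qnorm g = p * k -> qnorm h * k = s ^+ 2 * l ->
  qnorm g' = p * l.
Proof.
move=> s0 gh ng nh; have := qnorm_scale s g'; rewrite -gh qnormM ng => E.
have s20 : s ^+ 2 != 0 by rewrite expf_neq0.
apply: (mulfI s20); rewrite -E -mulrA [k * _]mulrC nh; ring.
Qed.

(* A quaternion of even norm has its coordinates split in two pairs of equal
   parity, so that right multiplication by 1+i, 1+j or 1+k makes it even. *)
Lemma even_qnorm_half (g : quaternion int) (c : int) : qnorm g = 2 * c ->
  exists h g', qnorm h = 2 /\ qmul g h = qscale 2 g'.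
Proof.
case: g => a b c' d /= E.
have par (z : int) : exists t (e : bool), z = 2 * t + e%:Z.
  exists (divz z 2), (odd `|z|%N).
  lia.
have [a1 [ea Ea]] := par a; have [b1 [eb Eb]] := par b.
have [c1 [ec Ec]] := par c'; have [d1 [ed Ed]] := par d.
have hp : ~~ (ea (+) eb (+) ec (+) ed).
  have : exists q : int, (ea%:Z + eb%:Z + ec%:Z + ed%:Z) = 2 * q.
    (* A bit equals its square, so the sum of the four parities is the norm 2c minus 4 times the
       bracketed sum. *)
    exists (c - 2 * (a1 ^+ 2 + b1 ^+ 2 + c1 ^+ 2 + d1 ^+ 2 + a1 * ea%:Z + b1 * eb%:Z
            + c1 * ec%:Z + d1 * ed%:Z)).
    have sq (e : bool) : e%:Z = e%:Z ^+ 2 by case: e.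
    rewrite mulrBr -E Ea Eb Ec Ed [in LHS](sq ea) [in LHS](sq eb) [in LHS](sq ec) [in LHS](sq ed).
    ring.
  by case: (ea) (eb) (ec) (ed) => [] [] [] [] //= [q]; lia.
have [e1|e1|e1] : [\/ ea = eb /\ ec = ed, ea = ec /\ eb = ed | ea = ed /\ eb = ec].
  move: hp; case: (ea) (eb) (ec) (ed) => [] [] [] [] //= _;
  by [apply: Or31 | apply: Or32 | apply: Or33].
- case: e1 => e1 e2; rewrite Ea Eb Ec Ed e1 e2.
  exists (Quaternion 1 1 0 0), (Quaternion (a1 - b1) (a1 + b1 + eb%:Z) (c1 + d1 + ed%:Z) (d1 - c1)).
  by split => //=; congr Quaternion; ring.
- case: e1 => e1 e2; rewrite Ea Eb Ec Ed e1 e2.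
  exists (Quaternion 1 0 1 0), (Quaternion (a1 - c1) (b1 - d1) (a1 + c1 + ec%:Z) (b1 + d1 + ed%:Z)).
  by split => //=; congr Quaternion; ring.
- case: e1 => e1 e2; rewrite Ea Eb Ec Ed e1 e2.
  exists (Quaternion 1 0 0 1), (Quaternion (a1 - d1) (b1 + c1 + ec%:Z) (c1 - b1) (a1 + d1 + ed%:Z)).
  by split => //=; congr Quaternion; ring.
Qed.

Lemma sum4_lt (R : realDomainType) (a b c d e : R) :
  4 * a < e -> 4 * b < e -> 4 * c < e -> 4 * d < e -> a + b + c + d < e.
Proof. lra. Qed.

(** Lagrange's reduction: write g = r + k t with balanced residues r and take h = conj(r). Expanding
    N(g - k t) gives a multiple k l of k, and it is below k^2 because each coordinate of r is below
    k/2 in absolute value. *)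
Lemma odd_qnorm_reduce (g : quaternion int) (k c : nat) :
  odd k -> qnorm g = k%:Z * c%:Z -> ~~ (k %| c)%N ->
  exists h g' (l : nat), [/\ (0 < l < k)%N, qnorm h = k%:Z * l%:Z & qmul g h = qscale k%:Z g'].
Proof.
case: g => a0 a1 a2 a3 k_odd /= Ng ndiv.
have k0 : 0 < k%:Z by case: (k) k_odd.
have [r0 [t0 [E0 l0]]] := balanced_residue a0 k_odd.
have [r1 [t1 [E1 l1]]] := balanced_residue a1 k_odd.
have [r2 [t2 [E2 l2]]] := balanced_residue a2 k_odd.
have [r3 [t3 [E3 l3]]] := balanced_residue a3 k_odd.
pose h := Quaternion r0 r1 r2 r3.
pose l : int := c%:Z - 2 * (r0 * t0 + r1 * t1 + r2 * t2 + r3 * t3) 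
                - k%:Z * (t0 ^+ 2 + t1 ^+ 2 + t2 ^+ 2 + t3 ^+ 2).
have Nh : qnorm h = k%:Z * l.
  rewrite /l !mulrBr -Ng E0 E1 E2 E3 /=; ring.
have Nh0 : 0 <= qnorm h by rewrite /= !addr_ge0 ?sqr_ge0.
have Nhk : qnorm h < k%:Z ^+ 2 by exact: sum4_lt.
have l_lt : l < k%:Z by rewrite -(ltr_pM2l k0) -Nh -expr2.
have l_ge : 0 <= l by rewrite -(pmulr_rge0 _ k0) -Nh.
(* If l = 0 then r = 0, so g = k t and k c = k^2 N(t), whence k divides c. *)
have l_ne : l != 0.
  apply: contra ndiv => /eqP l0'; move: Nh; rewrite l0' mulr0 /h /=.
  move=> /eqP; rewrite !paddr_eq0 ?addr_ge0 ?sqr_ge0 // !sqrf_eq0.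
  move=> /andP [/andP [/andP [/eqP z0 /eqP z1] /eqP z2] /eqP z3].
  move: Ng; rewrite E0 E1 E2 E3 z0 z1 z2 z3 => Ng.
  have : c%:Z = k%:Z * (t0 ^+ 2 + t1 ^+ 2 + t2 ^+ 2 + t3 ^+ 2).
    by apply: (mulfI (_ : k%:Z != 0)); [rewrite gt_eqF | rewrite -Ng; ring].
  by move=> E; apply/(@dvdzP k%:Z c%:Z); exists (t0 ^+ 2 + t1 ^+ 2 + t2 ^+ 2 + t3 ^+ 2); rewrite E mulrC.
exists (qconj h).
(* This is c - g conj(t), because g conj(r) = N(g) - k g conj(t). *)
exists (Quaternion (c%:Z - (a0 * t0 + a1 * t1 + a2 * t2 + a3 * t3))
                   (a0 * t1 - a1 * t0 + a2 * t3 - a3 * t2)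
                   (a0 * t2 - a2 * t0 + a3 * t1 - a1 * t3)
                   (a0 * t3 - a3 * t0 + a1 * t2 - a2 * t1)), `|l|%N.
have lE : `|l|%N = l :> int by rewrite gez0_abs.
have l_bds : (0 < `|l| < k)%N by clear -l_lt l_ge l_ne; lia.
split; [by [] | by rewrite qnorm_conj lE |].
rewrite /=; congr Quaternion.
- rewrite mulrBr -Ng E0 E1 E2 E3; ring.
- rewrite E0 E1 E2 E3; ring.
- rewrite E0 E1 E2 E3; ring.
- rewrite E0 E1 E2 E3; ring.
Qed.

Lemma descent (p : nat) (x : 'cV[int]_3) : prime p -> odd p ->
  forall (k : nat) g, (0 < k < p)%N -> qnorm g = p%:Z * k%:Z ->
  (exists y, Euler_matrix (qconj g) *m x = p%:Z ^+ 2 *: y) ->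
  exists2 a, qnorm a = p%:Z & exists y, Euler_matrix (qconj a) *m x = p%:Z ^+ 2 *: y.
Proof.
move=> p_pr p_odd; elim/ltn_ind => k IH g /andP [k_gt0 k_lt] Ng Hg.
(* The divisors s used below, 2 and k, are positive and smaller than the prime p. *)
have cop (s : nat) : (0 < s < p)%N -> coprimez s%:Z p%:Z.
  move=> /andP [s0 sp]; rewrite /coprimez /gcdz /= eqz_nat -/(coprime s p) coprime_sym prime_coprime //.
  by rewrite gtnNdvd.
have p2 := odd_prime_gt2 p_odd p_pr.
have [k_odd|k_even] := boolP (odd k); last first.
  have kE : k = (2 * k./2)%N by lia.
  have [|h [g' [Nh gh]]] := @even_qnorm_half g (p%:Z * (k./2)%:Z).
    by rewrite Ng {1}kE PoszM; ring.
  apply: (IH k./2 _ g'); [lia | lia | | exact: (descent_step (cop 2%N ltac:(lia)) gh)].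
  by apply: (qnorm_step _ gh Ng) => //; rewrite Nh {1}kE PoszM; ring.
have [k1|k1] := eqVneq k 1%N; first by exists g => //; rewrite Ng k1 mulr1.
(* The cofactor of k in the norm is p, which k does not divide since 1 < k < p. *)
have [||h [g' [l [/andP [l0 lk] Nh gh]]]] := @odd_qnorm_reduce g k p k_odd.
- by rewrite Ng mulrC.
- by apply/negP => /(primeP p_pr).2; rewrite (negPf k1) (ltn_eqF k_lt).
apply: (IH l _ g'); [lia | lia | | exact: (descent_step (cop k ltac:(lia)) gh)].
by apply: (qnorm_step _ gh Ng); [lia | rewrite Nh; ring].
Qed.

(** * Vectors whose norm is divisible by the square of a prime *)

Lemma colP3 (R : Type) (u v : 'cV[R]_3) :
  u 0 0 = v 0 0 -> u 1 0 = v 1 0 -> u 2%:R 0 = v 2%:R 0 -> u = v.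
Proof. by move=> ? ? ?; apply/colP; elim/forall_ord3. Qed.

Definition vec3 (R : Type) (a b c : R) : 'cV[R]_3 :=
  \col_i if i == 0 then a else if i == 1 then b else c.

Lemma dot3 (u v : 'cV[int]_3) :
  dot u v = u 0 0 * v 0 0 + u 1 0 * v 1 0 + u 2%:R 0 * v 2%:R 0.
Proof. exact: sum3. Qed.

Lemma scalemx_inj (m n : nat) (s : int) (A B : 'M[int]_(m, n)) :
  s != 0 -> s *: A = s *: B -> A = B.
Proof.
move=> s0 /matrixP E; apply/matrixP => i j; apply: (mulfI s0).
by have := E i j; rewrite !mxE.
Qed.

(** Modulo 4 the norm counts the odd coordinates; there are at most three of them, hence none. *)
Lemma norm_dvd4 (x : 'cV[int]_3) (c : int) : norm x = 4 * c -> exists y, x = 2 *: y.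
Proof.
rewrite /norm dot3 => E.
have par (z : int) : exists t (e : bool), z = 2 * t + e%:Z.
  by exists (divz z 2), (odd `|z|%N); lia.
have [a [ea Ea]] := par (x 0 0); have [b [eb Eb]] := par (x 1 0).
have [d [ed Ed]] := par (x 2%:R 0).
have sq (e : bool) : e%:Z * e%:Z = e%:Z by case: e.
have {}E : ea%:Z + eb%:Z + ed%:Z =
    4 * (c - (a ^+ 2 + b ^+ 2 + d ^+ 2 + a * ea%:Z + b * eb%:Z + d * ed%:Z)).
  rewrite mulrBr -E Ea Eb Ed -[in LHS](sq ea) -[in LHS](sq eb) -[in LHS](sq ed); ring.
have : [&& ~~ ea, ~~ eb & ~~ ed].
  by move: E; set q := (c - _); clearbody q; clear;
     case: ea eb ed => [] [] [] //=; lia.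
move=> /and3P [/negPf ea0 /negPf eb0 /negPf ed0].
exists (vec3 a b d); apply: colP3; rewrite !mxE /=.
- by rewrite Ea ea0 addr0.
- by rewrite Eb eb0 addr0.
- by rewrite Ed ed0 addr0.
Qed.

Lemma prime_edge (p : nat) (x : 'cV[int]_3) (c : int) :
  prime p -> norm x = p%:Z ^+ 2 * c ->
  (exists y, x = p%:Z *: y) \/
  (exists a y, qnorm a = p%:Z /\ x = Euler_matrix a *m y).
Proof.
move=> p_pr Nx; have [p2|p_odd] := even_prime p_pr.
  by left; rewrite p2 in Nx *; exact: norm_dvd4 Nx.
have p0 : 0 < p%:Z by rewrite ltz_nat prime_gt0.
have [r0 [t0 [E0 l0]]] := balanced_residue (x 0 0) p_odd.
have [r1 [t1 [E1 l1]]] := balanced_residue (x 1 0) p_odd.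
have [r2 [t2 [E2 l2]]] := balanced_residue (x 2%:R 0) p_odd.
pose s := t0 * x 0 0 + t1 * x 1 0 + t2 * x 2%:R 0.
pose T := t0 ^+ 2 + t1 ^+ 2 + t2 ^+ 2.
pose g := Quaternion 0 r0 r1 r2.
(* Expanding N(x - p t), the norm of the residue r, gives p k; so k = 0 means r = 0 and x = p t. *)
pose k := p%:Z * c - 2 * s + p%:Z * T.
move: (Nx); rewrite /norm dot3 => Nx3.
have r0E : r0 = x 0 0 - p%:Z * t0 by rewrite E0 addrK.
have r1E : r1 = x 1 0 - p%:Z * t1 by rewrite E1 addrK.
have r2E : r2 = x 2%:R 0 - p%:Z * t2 by rewrite E2 addrK.
have Ng : qnorm g = p%:Z * k.
  have -> : p%:Z * k = p%:Z ^+ 2 * c - p%:Z * (2 * s) + p%:Z ^+ 2 * T by rewrite /k; ring.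
  rewrite -Nx3 /= r0E r1E r2E /s /T; ring.
have [k0|k_ne] := eqVneq k 0.
  left; exists (vec3 t0 t1 t2); move: Ng; rewrite k0 mulr0 /= expr0n add0r => /eqP.
  rewrite !paddr_eq0 ?addr_ge0 ?sqr_ge0 // !sqrf_eq0.
  move=> /andP [/andP [/eqP z0 /eqP z1] /eqP z2].
  by apply: colP3; rewrite !mxE /= (E0, E1, E2) (z0, z1, z2) add0r.
right.
have k_gt0 : 0 < k.
  by rewrite lt_def k_ne -(pmulr_rge0 _ p0) -Ng /= !addr_ge0 ?sqr_ge0.
have k_lt : k < p%:Z.
  rewrite -(ltr_pM2l p0) -Ng -expr2 /=; apply: sum4_lt => //.
  by rewrite expr0n mulr0 exprn_gt0.
have k_bds : (0 < `|k| < p)%N by clear -k_gt0 k_lt; lia.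
have kE : `|k|%N = k :> int by rewrite gez0_abs // ltW.
have [||a Na [y Ey]] := @descent p x p_pr p_odd _ g k_bds.
- by rewrite kE.
(* For pure r, conj(r) x r = 2 (r.x) r - N(r) x. Substituting r = x - p t, the two terms in p s x
   cancel and p^2 times the vector given by [f] remains. *)
- pose f (u t : int) := c * u - (2 * p%:Z * c - 2 * s) * t - T * u.
  exists (vec3 (f (x 0 0) t0) (f (x 1 0) t1) (f (x 2%:R 0) t2)).
  have key (u t : int) :
      p%:Z ^+ 2 * f u t =
      p%:Z ^+ 2 * c * (u - 2 * p%:Z * t) + p%:Z ^+ 2 * (2 * s * t - T * u) by rewrite /f; ring.
  by apply: colP3; rewrite [RHS]mxE [X in _ = _ * X]mxE /= key -Nx3 mxE sum3 !mxE /=;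
    rewrite r0E r1E r2E /s /T; ring.
exists a, y; split=> //.
have p4 : p%:Z ^+ 2 != 0 by rewrite expf_neq0 // gt_eqF.
apply: (scalemx_inj p4); rewrite scalemxAr -Ey mulmxA Euler_mul_conj Na.
by rewrite mul_scalar_mx.
Qed.

(** * The dot product, and existence by induction on the edge length *)

Lemma dotE (u v : 'cV[int]_3) : dot u v = (u^T *m v) 0 0.
Proof. by rewrite mxE; apply: eq_bigr => i _; rewrite mxE. Qed.

Lemma dot_mul (A : 'M[int]_3) (u v : 'cV[int]_3) : dot (A *m u) v = dot u (A^T *m v).
Proof. by rewrite !dotE trmx_mul mulmxA. Qed.

Lemma dotZr (s : int) (u v : 'cV[int]_3) : dot u (s *: v) = s * dot u v.
Proof. by rewrite !dotE -scalemxAr mxE. Qed.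

Lemma dotZl (s : int) (u v : 'cV[int]_3) : dot (s *: u) v = s * dot u v.
Proof. by rewrite !dotE linearZ -scalemxAl mxE. Qed.

Lemma dot_simil (A : 'M[int]_3) (s : int) (u v : 'cV[int]_3) :
  A^T *m A = s%:M -> dot (A *m u) (A *m v) = s * dot u v.
Proof. by move=> AA; rewrite dot_mul mulmxA AA mul_scalar_mx dotZr. Qed.

(** Primes are split off m one at a time: c collects those handled by scaling, a the quaternions
    found for the others. *)
Lemma Euler_factor (m : nat) : (0 < m)%N -> forall (n : int) (x : 'cV[int]_3),
  norm x = n * m%:Z ^+ 2 ->
  exists (c : int) a z, c * qnorm a = m%:Z /\ x = c *: (Euler_matrix a *m z).
Proof.
elim/ltn_ind: m => m IH m_gt0 n x Nx.
have [m1|m_gt1] := leqP m 1.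
  exists 1, (Quaternion 1 0 0 0), x; split; first by move=> /=; lia.
  rewrite scale1r (_ : Euler_matrix _ = 1%:M) ?mul1mx //.
  by apply/matrixP; elim/forall_ord3; elim/forall_ord3; rewrite !mxE.
pose p := pdiv m; have p_pr : prime p by exact: pdiv_prime.
have /dvdnP [m' mE] : (p %| m)%N by exact: pdiv_dvd.
have m'_gt0 : (0 < m')%N by move: m_gt0; rewrite mE; case: (m').
have m'_lt : (m' < m)%N by rewrite mE ltn_Pmulr // prime_gt1.
have p20 : p%:Z ^+ 2 != 0 by rewrite expf_neq0 // eqz_nat -lt0n prime_gt0.
have mEz : m%:Z = m'%:Z * p%:Z by rewrite mE PoszM.
have [|[y xE]|[b [y [Nb xE]]]] := @prime_edge p x (n * m'%:Z ^+ 2) p_pr.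
- by rewrite Nx mEz; ring.
- have /(IH m' m'_lt m'_gt0) [c [a [z [cm yE]]]] : norm y = n * m'%:Z ^+ 2.
    apply: (mulfI p20); transitivity (norm x); last by rewrite Nx mEz; ring.
    by rewrite xE /norm dotZl dotZr expr2 mulrA.
  exists (p%:Z * c), a, z; split; first by rewrite mEz -cm; ring.
  by rewrite xE yE scalerA.
have /(IH m' m'_lt m'_gt0) [c [a [z [cm yE]]]] : norm y = n * m'%:Z ^+ 2.
  apply: (mulfI p20); transitivity (norm x); last by rewrite Nx mEz; ring.
  rewrite xE /norm (dot_simil (s := p%:Z ^+ 2)) //.
  by rewrite -Euler_conj Euler_conj_mul Nb.
exists c, (qmul b a), z; split; first by rewrite qnormM Nb mEz -cm; ring.
by rewrite xE yE Euler_qmul -scalemxAr mulmxA.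
Qed.

(** * Cross products and determinants *)

Definition cross (R : comNzRingType) (u v : 'cV[R]_3) : 'cV[R]_3 :=
  vec3 (u 1 0 * v 2%:R 0 - u 2%:R 0 * v 1 0)
       (u 2%:R 0 * v 0 0 - u 0 0 * v 2%:R 0)
       (u 0 0 * v 1 0 - u 1 0 * v 0 0).

Lemma det_mx33 (R : comNzRingType) (A : 'M[R]_3) :
  \det A = A 0 0 * (A 1 1 * A 2%:R 2%:R - A 1 2%:R * A 2%:R 1)
         - A 0 1 * (A 1 0 * A 2%:R 2%:R - A 1 2%:R * A 2%:R 0)
         + A 0 2%:R * (A 1 0 * A 2%:R 1 - A 1 1 * A 2%:R 0).
Proof.
(* Indexing the entries by naturals lets different ordinal expressions of one index agree after
   computation. *)
pose f (i j : nat) := A (inord i) (inord j).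
have fE i j : A i j = f i j by rewrite /f !inord_val.
rewrite (expand_det_row _ 0) sum3 /cofactor !(expand_det_row _ 0).
rewrite !big_ord_recl !big_ord0 /cofactor !det_mx11 !mxE !fE /= /bump /=.
ring.
Qed.

(** The pairing of either side with w is det(Au, Av, Aw) = det(A) det(u, v, w). *)
Lemma tr_mul_cross (R : comNzRingType) (A : 'M[R]_3) (u v : 'cV[R]_3) :
  A^T *m cross (A *m u) (A *m v) = \det A *: cross u v.
Proof.
by rewrite det_mx33; apply: colP3; rewrite !mxE !sum3 !mxE /= ?mxE ?sum3; ring.
Qed.

Lemma cross_cross (q y x : 'cV[int]_3) :
  cross q (cross y x) = dot q x *: y - dot q y *: x.
Proof. by rewrite !dot3; apply: colP3; rewrite !mxE /=; ring. Qed.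

Lemma crossZr (R : comNzRingType) (s : R) (u v : 'cV[R]_3) :
  cross u (s *: v) = s *: cross u v.
Proof. by apply: colP3; rewrite !mxE /=; ring. Qed.

Lemma dotC (u v : 'cV[int]_3) : dot u v = dot v u.
Proof. by apply: eq_bigr => i _; rewrite mulrC. Qed.

Lemma dotDl (u v w : 'cV[int]_3) : dot (u + v) w = dot u w + dot v w.
Proof. by rewrite !dotE linearD mulmxDl mxE. Qed.

(** * Integer similitudes and the intrinsic description of their lattices *)

Section Similitude.
Variables (m : int) (A : 'M[int]_3).
Hypotheses (m_neq0 : m != 0) (AtA : A^T *m A = (m ^+ 2)%:M).

Lemma simil_det : \det A = m ^+ 3 \/ \det A = - m ^+ 3.
Proof.
have : \det A ^+ 2 == (m ^+ 3) ^+ 2.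
  by rewrite expr2 -{1}det_tr -det_mulmx AtA det_scalar -!exprM.
by rewrite eqf_sqr => /orP [] /eqP ->; [left | right].
Qed.

(** A left inverse up to scaling is also a right one: the difference of the two sides is killed by A
    on its right, hence by det(A), which is nonzero. *)
Lemma simil_mul_tr : A *m A^T = (m ^+ 2)%:M.
Proof.
have detA : \det A != 0.
  by case: simil_det => ->; rewrite ?oppr_eq0 expf_neq0.
apply/eqP; rewrite -subr_eq0; apply/eqP; set B := _ - _.
have BA : B *m A = 0.
  by rewrite mulmxBl -mulmxA AtA mul_mx_scalar mul_scalar_mx subrr.
apply: (scalemx_inj detA); rewrite scaler0 -mul_mx_scalar -mul_mx_adj.
by rewrite mulmxA BA mul0mx.
Qed.

(** Multiplying [tr_mul_cross] by A gives m^2 (Au x Av) = det(A) A(u x v), where det(A) is m^3 or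
    -m^3. *)
Lemma simil_cross (u v : 'cV[int]_3) :
  exists w, cross (A *m u) (A *m v) = m *: (A *m w).
Proof.
have [e detA] : exists e, \det A = m ^+ 2 * (m * e).
  by case: simil_det => ->; [exists 1 | exists (- 1)]; ring.
exists (e *: cross u v); apply: (scalemx_inj (expf_neq0 2 m_neq0)).
rewrite -mul_scalar_mx -simil_mul_tr -mulmxA tr_mul_cross detA.
by rewrite -!scalemxAr !scalerA mulrA.
Qed.

Variables (x z q : 'cV[int]_3).
Hypotheses (xE : x = A *m z) (qx : dot q x = 1).

(** For y = Ab, the triple product q x (y x x) = (q.x) y - (q.y) x has q.x = 1, and its inner factor
    is m times a lattice vector. Then m (t.x) = y.x - l (x.x) is a multiple of m^2, as are all dot
    products within the lattice. *)
Lemma simil_lattice_sub (b : 'cV[int]_3) :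
  exists l t s, A *m b = l *: x + m *: t /\ dot t x = m * s.
Proof.
have [w cE] := simil_cross b z; rewrite -xE in cE.
pose l := dot q (A *m b); pose t := cross q (A *m w).
have bE : A *m b = l *: x + m *: t.
  have := cross_cross q (A *m b) x; rewrite qx scale1r cE crossZr => ->.
  by rewrite addrC subrK.
exists l, t, (dot b z - l * dot z z); split=> //.
apply: (mulfI m_neq0); rewrite -(dotZl m t) (_ : m *: t = A *m b - l *: x); last first.
  by rewrite bE addrC addKr.
rewrite dotDl -scaleNr dotZl {1 2 3}xE !(dot_simil _ _ AtA); ring.
Qed.

(* This description of the lattice mentions A only through x, whence uniqueness. *)
Lemma simil_latticeP (y : 'cV[int]_3) :
  (exists b, y = A *m b) <->
  exists l t s, y = l *: x + m *: t /\ dot t x = m * s.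
Proof.
split=> [[b ->] | [l [t [s [-> tx]]]]]; first exact: simil_lattice_sub.
(* From A^T t = m r and A A^T = m^2 it follows that m t = A r lies in the lattice. *)
suff [r tE] : exists r, A^T *m t = m *: r.
  exists (l *: z + r); rewrite mulmxDr -scalemxAr -xE; congr (_ + _).
  apply: (scalemx_inj m_neq0); rewrite scalerA -expr2 -mul_scalar_mx.
  by rewrite -simil_mul_tr -mulmxA tE -scalemxAr.
exists (\col_i divz ((A^T *m t) i 0) m); apply/colP => i; rewrite [RHS]mxE [X in m * X]mxE.
rewrite mulrC divzK //.
have -> : (A^T *m t) i 0 = dot (A *m delta_mx i 0) t.
  by rewrite dot_mul dotE trmx_delta -rowE [RHS]mxE.
(* The column A e_i is l' x + m t', so its product with t is divisible by m because t.x is. *)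
have [l' [t' [s' [-> _]]]] := simil_lattice_sub (delta_mx i 0).
by rewrite dotDl !dotZl (dotC x) tx mulrCA -mulrDr dvdz_mulr.
Qed.

End Similitude.

(** * Icubes and their lattices as integer matrices *)

Lemma inIntSpan_colP (A : 'M[int]_3) (s : 3.-tuple 'cV[int]_3) (y : 'cV[int]_3) :
  (forall i : 'I_3, s`_i = col i A) ->
  inIntSpan s y <-> exists b, y = A *m b.
Proof.
move=> sE.
have mulE (b : 'cV[int]_3) : A *m b = \sum_(i < 3) s`_i *~ b i 0.
  apply/colP => j; rewrite summxE mxE; apply: eq_bigr => i _.
  by rewrite sE -scaler_int intz !mxE mulrC.
split=> [[a ->] | [b ->]].
  by exists (\col_i a i); rewrite mulE; apply: eq_bigr => i _; rewrite mxE.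
by exists [ffun i => b i 0]; rewrite mulE; apply: eq_bigr => i _; rewrite ffunE.
Qed.

Lemma column_latticeP (A : 'M[int]_3) (y : 'cV[int]_3) :
  column_lattice A y <-> exists b, y = A *m b.
Proof. by apply: inIntSpan_colP => i; rewrite -tnth_nth tnth_mktuple. Qed.

Lemma cubic_lattice_col (A : 'M[int]_3) (y : 'cV[int]_3) :
  cubic_lattice (col 0 A) (col 1 A) (col 2%:R A) y <-> exists b, y = A *m b.
Proof. by apply: inIntSpan_colP; elim/forall_ord3. Qed.

Lemma tr_mulE (A : 'M[int]_3) i j : (A^T *m A) i j = dot (col i A) (col j A).
Proof. by rewrite mxE; apply: eq_bigr => k _; rewrite !mxE. Qed.

(** The matrix A^T A is the Gram matrix of the columns; its diagonal m^2 > 0 makes them nonzero. *)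
Lemma icube_col (m : nat) (A : 'M[int]_3) : (0 < m)%N ->
  icube_of_edge m (col 0 A) (col 1 A) (col 2%:R A) <-> A^T *m A = (m%:Z ^+ 2)%:M.
Proof.
move=> m_gt0; have m2E : (m ^ 2)%N%:Z = m%:Z ^+ 2 by rewrite -mulnn PoszM expr2.
split=> [[[_ [d01 d02 d12] [n01 n12]]] n0 | AtA].
  rewrite m2E in n0; move: n12; rewrite -n01 n0 => /esym n2; move: n01; rewrite n0 => /esym n1.
  have [d10 d20 d21] : [/\ dot (col 1 A) (col 0 A) = 0, dot (col 2%:R A) (col 0 A) = 0
                          & dot (col 2%:R A) (col 1 A) = 0] by split; rewrite dotC.
  by apply/matrixP; elim/forall_ord3; elim/forall_ord3; rewrite tr_mulE mxE.
have dE i j : dot (col i A) (col j A) = m%:Z ^+ 2 *+ (i == j).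
  by rewrite -tr_mulE AtA mxE.
have nz i : col i A != 0.
  apply/eqP => i0; have := dE i i; rewrite i0 eqxx dotE mulmx0 mxE => /esym/eqP.
  by rewrite mulr1n sqrf_eq0; case: (m) m_gt0.
by split; [split; [split | split | split] | ]; rewrite ?nz /norm ?dE ?m2E.
Qed.

Lemma cols_exist (R : Type) (u v w : 'cV[R]_3) :
  exists A : 'M_3, [/\ col 0 A = u, col 1 A = v & col 2%:R A = w].
Proof.
exists (\matrix_(i, j) (if j == 0 then u else if j == 1 then v else w) i 0).
by split; apply/colP => i; rewrite !mxE.
Qed.

Lemma primitive_Bezout (x : 'cV[int]_3) : primitive x -> exists q, dot q x = 1.
Proof.
rewrite /primitive !big_ord_recl big_ord0 => xP.
have l1 : lift ord0 ord0 = 1 :> 'I_3 by exact: val_inj.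
have l2 : lift ord0 (lift ord0 ord0) = 2%:R :> 'I_3 by exact: val_inj.
have [a [a' aE]] := Bezoutz (x 2%:R 0) 0.
have [b [b' bE]] := Bezoutz (x 1 0) (gcdz (x 2%:R 0) 0).
have [c [c' cE]] := Bezoutz (x 0 0) (gcdz (x 1 0) (gcdz (x 2%:R 0) 0)).
rewrite l2 l1 -cE -bE -aE in xP.
(* Unfolds the nested combination c x_0 + c' (b x_1 + b' (a x_2 + a' 0)). *)
exists (vec3 c (c' * b) (c' * b' * a)); rewrite dot3 !mxE /= -xP; ring.
Qed.

Theorem theorem1p5 (x : 'cV[int]_3) (n m : nat)
    (n_gt0 : (0 < n)%N) (m_gt0 : (0 < m)%N) (n_sqfree : squarefree n)
    (norm_x : norm x = (n * m ^ 2)%:Z) :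
  (exists u v w : 'cV[int]_3,
     icube_of_edge m u v w /\ cubic_lattice u v w x) /\
  (primitive x ->
   exists u v w : 'cV[int]_3,
     [/\ icube_of_edge m u v w,
         cubic_lattice u v w x,
         forall u' v' w' : 'cV[int]_3,
           icube_of_edge m u' v' w' -> cubic_lattice u' v' w' x ->
           forall y : 'cV[int]_3,
             cubic_lattice u' v' w' y <-> cubic_lattice u v w y
       & exists alpha : quaternion int,
           forall y : 'cV[int]_3,
             cubic_lattice u v w y <-> column_lattice (Euler_matrix alpha) y]).
Proof.
have m_neq0 : m%:Z != 0 by case: (m) m_gt0.
have [|c [a [z [cm xE]]]] := Euler_factor m_gt0 (n := n%:Z) (x := x).
  by rewrite norm_x -mulnn !PoszM expr2.
(* Because c N(a) = m, this is m times an orthogonal matrix. *)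
pose A := c *: Euler_matrix a.
have {}xE : x = A *m z by rewrite xE scalemxAl.
have AtA : A^T *m A = (m%:Z ^+ 2)%:M.
  rewrite /A -scalemxAr [(_ *: _)^T]linearZ /= -scalemxAl -Euler_conj Euler_conj_mul -!mul_scalar_mx.
  by rewrite -!scalar_mxM -cm; congr _%:M; ring.
have cubeA := (icube_col A m_gt0).2 AtA.
have xA := (cubic_lattice_col A x).2 (ex_intro _ z xE).
split=> [|/primitive_Bezout [q qx]].
  by exists (col 0 A), (col 1 A), (col 2%:R A).
exists (col 0 A), (col 1 A), (col 2%:R A); split=> // [u v w|].
  have [B [<- <- <-]] := cols_exist u v w.
  move=> /(icube_col B m_gt0) BtB /cubic_lattice_col [z' xE'] y.
  rewrite !cubic_lattice_col (simil_latticeP m_neq0 BtB xE' qx).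
  by rewrite (simil_latticeP m_neq0 AtA xE qx).
exists a => y; rewrite cubic_lattice_col column_latticeP.
(* The integer c divides q.x = 1, and it is positive since c N(a) = m > 0 with N(a) >= 0. So for
   primitive x the edge matrix is E(a) itself. *)
have c1 : c = 1.
  have : c * dot q (Euler_matrix a *m z) = 1 by rewrite -dotZr scalemxAl -xE.
  have : 0 <= qnorm a by case: (a) => ? ? ? ? /=; rewrite !addr_ge0 ?sqr_ge0.
  move: cm; move: (qnorm a) (dot q _) => N d cN N_ge0 cd.
  have c_gt0 : 0 < c by clear -cN N_ge0 m_gt0; nia.
  have d_gt0 : 0 < d by clear -cd c_gt0; nia.
  clear -cd c_gt0 d_gt0; nia.
by rewrite /A c1 scale1r.
Qed.
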